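(* At full coupling $\gamma=1$, and for every $\theta$, the holistic discretisation $$\partial_tU_j=-\frac{2c}{H}\operatorname{asinh}\left[\frac{\tfrac12\gamma(\mu_j-\tfrac12\theta\delta_j)\delta_j}{\sqrt{1+\tfrac12\gamma\delta_j^2-\gamma\theta\mu_j\delta_j+\tfrac14\gamma^2(\theta^2-1)\delta_j^2}}\right]U_j$$ (equivalently, its expansion as a power series in $\gamma$, $\frac Hc\partial_tU_j=\big\{-\gamma\mu_j\delta_j+\tfrac12\theta\gamma(1-\gamma)\delta_j^2+\tfrac14\gamma^2[1-\tfrac13\gamma+\theta^2(1-\gamma)]\mu_j\delta_j^3+\cdots\big\}U_j$) is consistent with the first-order wave PDE $u_t+cu_x=0$.
   Context: $U_j(t)$, $j=1,\dots,N$, are macroscale grid values on a uniform periodic grid of spacing $H$; $c$ is the constant wave speed; $\theta$ is real. $E_j^{\pm1}U_j=U_{j\pm1}$; $\delta_j=E_j^{1/2}-E_j^{-1/2}$ and $\mu_j=\tfrac12(E_j^{1/2}+E_j^{-1/2})$ are the centred difference and mean operators, so $\mu_j^2=1+\tfrac14\delta_j^2$; operator functions are interpreted as power series in the operators. The discretisation arises from posing the wave PDE on equi-sized elements $\mathbb X_j=(L_j,R_j)$ of length $H$ coupled by $(1-\tfrac12\gamma)(u_j^R-u_j^L)=\tfrac12\gamma(u_{j+1}^L-u_{j-1}^R)+\tfrac12\gamma\theta(u_j^L+u_j^R)-\tfrac12\gamma\theta(u_{j+1}^L+u_{j-1}^R)$, superscripts $R,L$ denoting evaluation at the right/left edges of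 the relevant element. Consistency: interpolate $U_j(t)$ by a smooth field $U(t,x)$ such that one step in $j$ is one step of size $H$ in $x$; thus, acting on the macroscale field, $\delta_j=\delta_x=2\sinh(H\partial_x/2)$, $\mu_j=\mu_x=\cosh(H\partial_x/2)$ and $\partial_j=H\partial_x$. Substituting these power series in $\partial_x$ gives the equivalent PDE of the discretisation. The discretisation is consistent with the wave PDE when this equivalent PDE is $\partial_tU=-c\,\partial_xU$ (to all orders in $\partial_x$). *)

(* Defs.v *)
From HB Require Import structures.
From mathcomp Require Import all_boot all_order all_algebra.
From mathcomp Require Import boolp reals.

Set Implicit Arguments.
Unset Strict Implicit.
Unset Printing Implicit Defensive.

Import GRing.Theory.
Local Open Scope ring_scope.

(* Formal power series: [f n] is the coefficient of the n-th power of the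
   indeterminate.  They carry a comUnitRingType structure, so that they can be
   iterated: {fps {fps R}} is R[[x]][[y]], with y the outer indeterminate. *)
Record fps (A : Type) : Type := FPS { fps_coef :> nat -> A }.

Notation "{ 'fps' A }" := (fps A) (at level 0, format "{ 'fps'  A }").

Lemma fpsP (A : Type) (f g : {fps A}) : (forall n, f n = g n) -> f = g.
Proof. by case: f g => [f] [g] /= fg; congr FPS; apply: funext. Qed.

HB.instance Definition _ (A : Type) := gen_eqMixin {fps A}.
HB.instance Definition _ (A : Type) := gen_choiceMixin {fps A}.

Section FpsZmodule.
Variable A : zmodType.
Implicit Types f g h : {fps A}.

Definition fps_zero : {fps A} := FPS (fun=> 0).
Definition fps_opp f : {fps A} := FPS (fun n => - f n).
Definition fps_add f g : {fps A} := FPS (fun n => f n + g n).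

Fact fps_addA : associative fps_add.
Proof. by move=> f g h; apply: fpsP => n /=; rewrite addrA. Qed.
Fact fps_addC : commutative fps_add.
Proof. by move=> f g; apply: fpsP => n /=; rewrite addrC. Qed.
Fact fps_add0 : left_id fps_zero fps_add.
Proof. by move=> f; apply: fpsP => n /=; rewrite add0r. Qed.
Fact fps_addN : left_inverse fps_zero fps_opp fps_add.
Proof. by move=> f; apply: fpsP => n /=; rewrite addNr. Qed.

HB.instance Definition _ :=
  GRing.isZmodule.Build {fps A} fps_addA fps_addC fps_add0 fps_addN.

Lemma fps_coef0 n : (0 : {fps A}) n = 0. Proof. by []. Qed.
Lemma fps_coefN f n : (- f) n = - f n. Proof. by []. Qed.
Lemma fps_coefD f g n : (f + g) n = f n + g n. Proof. by []. Qed.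
End FpsZmodule.

Section FpsRing.
Variable A : comNzRingType.
Implicit Types f g h : {fps A}.

Definition fpsC (a : A) : {fps A} := FPS (fun n => if n == 0%N then a else 0).
Definition fpsX : {fps A} := FPS (fun n => (n == 1%N)%:R).
Definition fps_mul f g : {fps A} :=
  FPS (fun n => \sum_(i < n.+1) f i * g (n - i)%N).

Definition fps_trunc N f : {poly A} := \poly_(i < N) f i.

Lemma coef_fps_trunc N f n : (n < N)%N -> (fps_trunc N f)`_n = f n.
Proof. by move=> nN; rewrite coef_poly nN. Qed.

Lemma fps_mul_trunc N f g n : (n < N)%N ->
  fps_mul f g n = (fps_trunc N f * fps_trunc N g)`_n.
Proof.
move=> nN; rewrite coefM /=; apply: eq_bigr => i _.
rewrite !coef_fps_trunc // ?(leq_ltn_trans (leq_subr _ _)) //.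
by rewrite (leq_ltn_trans _ nN) // -ltnS.
Qed.

Fact fps_mulC : commutative fps_mul.
Proof.
by move=> f g; apply: fpsP => n; rewrite !(@fps_mul_trunc n.+1) // mulrC.
Qed.
Fact fps_mulA : associative fps_mul.
Proof.
have mulE f g h n : fps_mul f (fps_mul g h) n =
    (fps_trunc n.+1 f * (fps_trunc n.+1 g * fps_trunc n.+1 h))`_n.
  rewrite [RHS]coefM; apply: eq_bigr => i _.
  by rewrite coef_fps_trunc // (@fps_mul_trunc n.+1) // ltnS leq_subr.
move=> f g h; apply: fpsP => n.
by rewrite [fps_mul (fps_mul f g) h]fps_mulC !mulE mulrA mulrC.
Qed.
Fact fps_mul1 : left_id (fpsC 1) fps_mul.
Proof.
move=> f; apply: fpsP => n /=; rewrite big_ord_recl /= subn0 mul1r.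
by rewrite big1 ?addr0 // => i _; rewrite mul0r.
Qed.
Fact fps_mulDl : left_distributive fps_mul (@fps_add A).
Proof.
move=> f g h; apply: fpsP => n /=; rewrite -big_split /=.
by apply: eq_bigr => i _; rewrite mulrDl.
Qed.
Fact fps_oner_neq0 : fpsC 1 != 0.
Proof.
by apply/eqP => /(congr1 (fun f : {fps A} => f 0%N)) /eqP; rewrite oner_eq0.
Qed.

HB.instance Definition _ := GRing.Zmodule_isComNzRing.Build {fps A}
  fps_mulA fps_mulC fps_mul1 fps_mulDl fps_oner_neq0.

Lemma fps_coefM f g n : (f * g) n = \sum_(i < n.+1) f i * g (n - i)%N.
Proof. by []. Qed.

Lemma fps_coef1 n : (1 : {fps A}) n = (n == 0%N)%:R.
Proof. by rewrite /GRing.one /=; case: eqP. Qed.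

Lemma fps_coef_sum (I : Type) (r : seq I) (P : pred I) (F : I -> {fps A}) n :
  (\sum_(i <- r | P i) F i) n = \sum_(i <- r | P i) F i n.
Proof. exact: (big_morph (fun f : {fps A} => f n)). Qed.

Lemma fps_coefX_small f n k : f 0%N = 0 -> (n < k)%N -> (f ^+ k) n = 0.
Proof.
move=> f0; elim: k n => // k IHk n nk; rewrite exprS fps_coefM.
rewrite big_ord_recl f0 mul0r add0r big1 // => i _.
by rewrite IHk ?mulr0 //= /bump /=; case: n nk i => [|n] nk [i i_lt] //=;
  rewrite add1n subSS (leq_ltn_trans (leq_subr _ _)).
Qed.

(* Substitution f(g); meaningful when g has no constant term, in which case
   only the powers g^k with k <= n contribute to the n-th coefficient. *)
Definition fps_comp f g : {fps A} :=
  FPS (fun n => \sum_(k < n.+1) f k * (g ^+ k) n).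

End FpsRing.

Notation "c %:S" := (fpsC c) (at level 1, left associativity, format "c %:S").

Section FpsUnitRing.
Variable A : comUnitRingType.
Implicit Types f g : {fps A}.

Definition fps_unit : {pred {fps A}} := fun f => f 0%N \is a GRing.unit.

Definition fps_geom : {fps A} := FPS (fun=> 1).

Definition fps_inv f : {fps A} :=
  if f \in fps_unit
  then (f 0%N)^-1%:S * fps_comp fps_geom (1 - (f 0%N)^-1%:S * f)
  else f.

Fact fps_mulVx : {in fps_unit, left_inverse 1 fps_inv *%R}.
Proof.
move=> f fU; rewrite /fps_inv fU mulrAC; set u := _ * f.
have u0 : (1 - u) 0%N = 0.
  by rewrite fps_coefD fps_coefN fps_coef1 fps_coefM big_ord1 /= mulVr ?subrr.
set h := 1 - u in u0 *; apply: fpsP => n.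
have -> : u = 1 - h by rewrite /h opprB addrC subrK.
have geomE k : (k <= n)%N ->
    fps_comp fps_geom h k = (\sum_(i < n.+1) h ^+ i) k.
  move=> kn; rewrite fps_coef_sum /= -(subnKC kn) -addSn big_split_ord /=.
  rewrite [X in _ = _ + X]big1 ?addr0; last first.
    by move=> i _; apply: fps_coefX_small; rewrite // addSn ltnS leq_addr.
  by apply: eq_bigr => i _; rewrite mul1r.
have -> : ((1 - h) * fps_comp fps_geom h) n =
          ((1 - h) * \sum_(i < n.+1) h ^+ i) n.
  rewrite !fps_coefM; apply: eq_bigr => i _.
  by rewrite geomE ?leq_subr.
have -> : (1 - h) * (\sum_(i < n.+1) h ^+ i) = 1 - h ^+ n.+1.
  by rewrite -(opprB h) mulNr -subrX1 opprB.
by rewrite fps_coefD fps_coefN fps_coefX_small ?subr0.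
Qed.

Fact fps_unitPl f g : g * f = 1 -> fps_unit f.
Proof.
move/(congr1 (fun h : {fps A} => h 0%N)).
rewrite fps_coefM big_ord1 fps_coef1 => gf.
by apply/unitrPr; exists (g 0%N); rewrite mulrC.
Qed.

Fact fps_inv_out : {in [predC fps_unit], fps_inv =1 id}.
Proof. by move=> f; rewrite inE /= /fps_inv => /negbTE ->. Qed.

HB.instance Definition _ := GRing.ComNzRing_hasMulInverse.Build {fps A}
  fps_mulVx fps_unitPl fps_inv_out.

Definition sinh_series : {fps A} :=
  FPS (fun n => if odd n then (n`!%:R)^-1 else 0).

Definition cosh_series : {fps A} :=
  FPS (fun n => if odd n then 0 else (n`!%:R)^-1).

(* asinh z = sum_k (-1)^k (2k)! / (4^k (k!)^2 (2k+1)) z^(2k+1) *)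
Definition asinh_series : {fps A} :=
  FPS (fun n => let k := n./2 in
    if odd n then (-1) ^+ k * (k.*2)`!%:R / (4 ^ k * k`! ^ 2 * n)%:R else 0).

(* sqrt (1 + z) = sum_n binom(1/2, n) z^n *)
Definition sqrt1p_series : {fps A} :=
  FPS (fun n => (\prod_(i < n) (2^-1 - i%:R)) / n`!%:R).

Definition fps_sinh f : {fps A} := fps_comp sinh_series f.
Definition fps_cosh f : {fps A} := fps_comp cosh_series f.
Definition fps_asinh f : {fps A} := fps_comp asinh_series f.

(* The root with constant term 1 of a series f with constant term 1. *)
Definition fps_sqrt f : {fps A} := fps_comp sqrt1p_series (f - 1).

(* The right-hand side of the holistic discretisation, as a function of the
   commuting operators mu and delta; the parameters c, H, theta and gamma are
   passed as elements of the same ring of operators. *)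
Definition holistic (c H theta gamma mu delta : {fps A}) : {fps A} :=
  - (2 * c / H) * fps_asinh
      (2^-1 * gamma * (mu - 2^-1 * theta * delta) * delta
       / fps_sqrt (1 + 2^-1 * gamma * delta ^+ 2 - gamma * theta * mu * delta
                   + 4^-1 * gamma ^+ 2 * (theta ^+ 2 - 1) * delta ^+ 2)).

End FpsUnitRing.

Section EquivalentPDE.
Variable R : realType.

(* From here on {fps R} is the ring of power series in d/dx acting on the
   macroscale field; the series G stands for the PDE  U_t = G(d/dx) U. *)
Definition dx : {fps R} := fpsX R.

Definition delta_x (H : R) : {fps R} := 2 * fps_sinh ((H / 2)%:S * dx).
Definition mu_x (H : R) : {fps R} := fps_cosh ((H / 2)%:S * dx).

(* A discretisation U_t = F(mu, delta) U on the grid of spacing H. *)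
Definition equivalent_PDE (H : R) (F : {fps R} -> {fps R} -> {fps R}) :
  {fps R} := F (mu_x H) (delta_x H).

Definition consistent_with_wave (c H : R)
    (F : {fps R} -> {fps R} -> {fps R}) : Prop :=
  equivalent_PDE H F = - c%:S * dx.

Definition holistic_scheme (c H theta gamma : R) (mu delta : {fps R}) :
  {fps R} := holistic c%:S H%:S theta%:S gamma%:S mu delta.

(* Expansion in powers of gamma: in {fps {fps R}} the indeterminate [fpsX] is
   gamma, and the coefficients are power series in d/dx. *)
Definition holistic_gamma_series (c H theta : R) : {fps {fps R}} :=
  holistic c%:S%:S H%:S%:S theta%:S%:S (fpsX _) (mu_x H)%:S (delta_x H)%:S.

(* The power series G in gamma, evaluated at the number g, sums to F: at each
   order m in d/dx its partial sums are eventually equal to F m. *)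
Definition gamma_sums_to (G : {fps {fps R}}) (g : R) (F : {fps R}) : Prop :=
  forall m : nat, exists M : nat, forall N : nat, (M <= N)%N ->
    (\sum_(n < N) (g ^+ n)%:S * G n) m = F m.

End EquivalentPDE.

(* Main.v *)
(** At [gamma = 1] the identity [mu^2 = 1 + delta^2/4] makes the radicand the
    square of [mu - theta delta/2], so the argument of asinh reduces to
    [delta/2 = sinh (H dx/2)] and the scheme to [- c dx].

    For a general coupling, the same formula read in [R[gamma][[d/dx]]] specialises
    to the scheme at any number gamma by evaluating the polynomial coefficients,
    and to the gamma series by exchanging the two variables.  Each order in d/dx
    is thus a polynomial in gamma, so the gamma series terminates there.

    The stated terms come from [asinh z = z - z^3/6 + O(z^4)] and
    [(1 + w)^(-1/2) = 1 - w/2 + 3w^2/8 + O(w^3)], with [z] and [w] divisible by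
    [delta]. *)

Require Import Defs.
From HB Require Import structures.
From mathcomp Require Import all_boot all_order all_algebra.
From mathcomp Require Import reals.
From mathcomp Require Import ring.

Set Implicit Arguments.
Unset Strict Implicit.
Unset Printing Implicit Defensive.

Import GRing.Theory.
Local Open Scope ring_scope.

(** * Substitution and formal differentiation of power series *)

Section Substitution.
Variable A : comNzRingType.
Implicit Types (f g h : {fps A}) (p : {poly A}).

Fact fpsC_is_zmod_morphism : zmod_morphism (@fpsC A).
Proof. by move=> a b; apply: fpsP => -[|n] //=; rewrite subr0. Qed.

Fact fpsC_is_monoid_morphism : monoid_morphism (@fpsC A).
Proof.
split=> // a b; apply: fpsP => -[|n].
  by rewrite fps_coefM big_ord1.
rewrite fps_coefM big_ord_recl /= mulr0 big1 ?addr0 // => i _.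
by rewrite mul0r.
Qed.

HB.instance Definition _ :=
  GRing.isZmodMorphism.Build A {fps A} (@fpsC A) fpsC_is_zmod_morphism.
HB.instance Definition _ :=
  GRing.isMonoidMorphism.Build A {fps A} (@fpsC A) fpsC_is_monoid_morphism.

Lemma fps_coefCM (a : A) f n : (a%:S * f) n = a * f n.
Proof.
rewrite fps_coefM big_ord_recl /= subn0 big1 ?addr0 // => i _.
by rewrite mul0r.
Qed.

Lemma fps_coefXM f n : (fpsX A * f) n = if n is m.+1 then f m else 0.
Proof.
case: n => [|n]; rewrite fps_coefM.
  by rewrite big_ord1 mul0r.
rewrite !big_ord_recl /= mul0r mul1r add0r subSS subn0 big1 ?addr0 // => i _.
by rewrite mul0r.
Qed.

Lemma fps_coef0M f g : (f * g) 0%N = f 0%N * g 0%N.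
Proof. by rewrite fps_coefM big_ord1. Qed.

Lemma fps_coef0X f n : (f ^+ n) 0%N = f 0%N ^+ n.
Proof. by elim: n => [|n IH]; rewrite ?expr0 ?fps_coef1 // !exprS fps_coef0M IH. Qed.

Lemma fps_coefM_eq f f' g g' n :
  (forall i, (i <= n)%N -> f i = f' i) ->
  (forall i, (i <= n)%N -> g i = g' i) -> (f * g) n = (f' * g') n.
Proof.
move=> ff gg; rewrite !fps_coefM; apply: eq_bigr => i _.
by rewrite ff ?gg ?leq_subr // -ltnS.
Qed.

(** Substitution of a polynomial, as a Horner value in the ring of series: laws known for
    polynomials pass to [fps_comp] through truncation. *)
Definition fps_eval p g : {fps A} := (map_poly (@fpsC A) p).[g].

Lemma coef_fps_eval p g n : g 0%N = 0 ->
  fps_eval p g n = \sum_(k < n.+1) p`_k * (g ^+ k) n.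
Proof.
move=> g0; pose N := (size p + n.+1)%N.
rewrite /fps_eval (@horner_coef_wide _ N); last first.
  by rewrite (leq_trans (size_poly _ _)) ?leq_addr.
rewrite fps_coef_sum /N addnC big_split_ord /= [X in _ + X]big1 ?addr0.
  by apply: eq_bigr => i _; rewrite coef_map; apply: fps_coefCM.
by move=> i _; rewrite coef_map [LHS]fps_coefCM fps_coefX_small ?mulr0 ?ltnS ?leq_addr.
Qed.

Lemma fps_comp_trunc N f g n : g 0%N = 0 -> (n < N)%N ->
  fps_comp f g n = fps_eval (fps_trunc N f) g n.
Proof.
move=> g0 nN; rewrite coef_fps_eval //; apply: eq_bigr => i _.
by rewrite coef_fps_trunc // (leq_ltn_trans _ nN) // -ltnS.
Qed.

(** In each degree only finitely many coefficients of [f] and [h] matter, so the claim reduces to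
    multiplicativity of polynomial evaluation. *)
Lemma fps_compM f h g : g 0%N = 0 ->
  fps_comp (f * h) g = fps_comp f g * fps_comp h g.
Proof.
move=> g0; apply: fpsP => n.
rewrite (fps_coefM_eq (n := n)
  (f' := fps_eval (fps_trunc n.+1 f) g) (g' := fps_eval (fps_trunc n.+1 h) g)).
- rewrite /fps_eval -hornerM -rmorphM -/(fps_eval _ g) coef_fps_eval //.
  apply: eq_bigr => i _; congr (_ * _).
  by rewrite -fps_mul_trunc.
- by move=> i i_n; rewrite (fps_comp_trunc (N := n.+1)).
- by move=> i i_n; rewrite (fps_comp_trunc (N := n.+1)).
Qed.

Lemma fps_compD f h g : fps_comp (f + h) g = fps_comp f g + fps_comp h g.
Proof.
apply: fpsP => n; rewrite fps_coefD -big_split /=; apply: eq_bigr => i _.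
by rewrite mulrDl.
Qed.

Lemma fps_compC a g : fps_comp a%:S g = a%:S.
Proof.
apply: fpsP => n /=; rewrite big_ord_recl expr0 fps_coef1 /= big1 ?addr0.
  by case: eqP; rewrite ?mulr1 ?mulr0.
by move=> i _; rewrite mul0r.
Qed.

Lemma fps_comp1 g : fps_comp 1 g = 1.
Proof. exact: fps_compC. Qed.

Lemma fps_compX g : g 0%N = 0 -> fps_comp (fpsX A) g = g.
Proof.
move=> g0; apply: fpsP => -[|n] /=; first by rewrite big_ord1 mul0r g0.
rewrite !big_ord_recl /= mul0r mul1r expr1 add0r big1 ?addr0 // => i _.
by rewrite mul0r.
Qed.

Lemma fps_comp_coef0 f g : (fps_comp f g) 0%N = f 0%N.
Proof. by rewrite /= big_ord1 expr0 fps_coef1 mulr1. Qed.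

(** Taylor formula with an explicit remainder, by repeatedly splitting off the constant term of [f].
    It supplies the remainders of the expansions in gamma. *)
Lemma fps_comp_split f g k : g 0%N = 0 ->
  fps_comp f g = \sum_(i < k) (f i)%:S * g ^+ i
                 + g ^+ k * fps_comp (FPS (fun n => f (k + n)%N)) g.
Proof.
move=> g0; elim: k f => [|k IH] f.
  by rewrite big_ord0 add0r expr0 mul1r; congr fps_comp; apply: fpsP.
have -> : fps_comp f g =
    (f 0%N)%:S + g * fps_comp (FPS (fun n => f n.+1)) g.
  have {1}-> : f = (f 0%N)%:S + fpsX A * FPS (fun n => f n.+1).
    apply: fpsP => -[|n]; rewrite fps_coefD fps_coefXM /= ?addr0 //.
    by rewrite add0r.
  by rewrite fps_compD fps_compM // fps_compC fps_compX.
rewrite {}IH big_ord_recl expr0 mulr1 mulrDr -addrA; congr (_ + (_ + _)).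
  rewrite mulr_sumr; apply: eq_bigr => i _.
  by rewrite mulrCA -exprS.
by rewrite mulrA -exprS.
Qed.

Definition fps_deriv f : {fps A} := FPS (fun n => f n.+1 *+ n.+1).

Lemma fps_coef_deriv f n : fps_deriv f n = f n.+1 *+ n.+1.
Proof. by []. Qed.

Lemma fps_deriv_trunc N f n : (n.+1 < N)%N ->
  fps_deriv f n = ((fps_trunc N f)^`())`_n.
Proof. by move=> nN; rewrite coef_deriv coef_fps_trunc. Qed.

Lemma fps_derivM f g : fps_deriv (f * g) = fps_deriv f * g + f * fps_deriv g.
Proof.
apply: fpsP => n.
have trM (u v : {fps A}) (p q : {poly A}) :
    (forall i, (i <= n)%N -> u i = p`_i) ->
    (forall i, (i <= n)%N -> v i = q`_i) -> (u * v) n = (p * q)`_n.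
  move=> up vq; rewrite fps_coefM coefM; apply: eq_bigr => i _.
  by rewrite up ?vq ?leq_subr // -ltnS.
rewrite fps_coefD (trM _ _ (fps_trunc n.+2 f)^`() (fps_trunc n.+2 g)).
- rewrite (trM _ _ (fps_trunc n.+2 f) (fps_trunc n.+2 g)^`()).
  + by rewrite -coefD -derivM coef_deriv -fps_mul_trunc.
  + by move=> i i_n; rewrite coef_fps_trunc // !ltnS ltnW.
  + by move=> i i_n; rewrite (@fps_deriv_trunc n.+2).
- by move=> i i_n; rewrite (@fps_deriv_trunc n.+2).
- by move=> i i_n; rewrite coef_fps_trunc // !ltnS ltnW.
Qed.

Lemma fps_derivD f g : fps_deriv (f + g) = fps_deriv f + fps_deriv g.
Proof. by apply: fpsP => n /=; rewrite mulrnDl. Qed.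

Lemma fps_derivC a : fps_deriv a%:S = 0.
Proof. by apply: fpsP => n /=; rewrite mul0rn. Qed.

Lemma fps_derivX : fps_deriv (fpsX A) = 1.
Proof. by apply: fpsP => -[|n]; rewrite fps_coef1 //= mul0rn. Qed.

Lemma fps_deriv_eval p g :
  fps_deriv (fps_eval p g) = fps_eval p^`() g * fps_deriv g.
Proof.
elim/poly_ind: p => [|p c IH].
  rewrite linear0 /fps_eval rmorph0 horner0 mul0r.
  by apply: fpsP => n /=; rewrite mul0rn.
rewrite derivD derivC derivM derivX addr0 mulr1.
move: IH; rewrite /fps_eval !rmorphD !rmorphM /= !map_polyC !map_polyX /=.
rewrite !hornerE fps_derivD fps_derivC addr0 fps_derivM => ->.
by ring.
Qed.

(** Chain rule, inherited from polynomials; differentiation lowers degrees by one, hence the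
    truncation at [n.+2]. *)
Lemma fps_deriv_comp f g : g 0%N = 0 ->
  fps_deriv (fps_comp f g) = fps_comp (fps_deriv f) g * fps_deriv g.
Proof.
move=> g0; apply: fpsP => n.
have -> : fps_deriv (fps_comp f g) n =
    fps_deriv (fps_eval (fps_trunc n.+2 f) g) n.
  by congr (_ *+ _); apply: fps_comp_trunc.
rewrite fps_deriv_eval; apply: fps_coefM_eq => // i i_n.
rewrite coef_fps_eval //; apply: eq_bigr => k _.
rewrite -fps_deriv_trunc // !ltnS (leq_trans _ i_n) // -ltnS //.
Qed.

End Substitution.

(** * The square root, hyperbolic and inverse hyperbolic series *)

Section SpecialSeries.
Variable A : comUnitRingType.
(** Stated for a ring rather than a field, so as to cover the reals, polynomials in gamma and power
    series in d/dx alike. *)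
Hypothesis natU : forall n, (n.+1%:R : A) \is a GRing.unit.
Implicit Types (f g q : {fps A}).

Lemma fps_unitE f : (f \is a GRing.unit) = (f 0%N \is a GRing.unit).
Proof. by []. Qed.

Lemma fps_coef_nat k n : (k%:R : {fps A}) n = if n == 0%N then k%:R else 0.
Proof. by rewrite -(rmorph_nat (@fpsC A)). Qed.

Lemma fps_natU n : (n.+1%:R : {fps A}) \is a GRing.unit.
Proof. by rewrite fps_unitE fps_coef_nat; apply: natU. Qed.

Lemma fact_unit n : (n`!%:R : A) \is a GRing.unit.
Proof. by case: n`! (fact_gt0 n) => // k _; apply: natU. Qed.

Lemma mulrSn_inj n (a b : A) : a *+ n.+1 = b *+ n.+1 -> a = b.
Proof. by rewrite -[a *+ _]mulr_natr -[b *+ _]mulr_natr => /mulIr; apply. Qed.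

Lemma invr_factS n : (n.+1`!%:R : A)^-1 *+ n.+1 = n`!%:R^-1.
Proof. by rewrite factS natrM invrM ?fact_unit // -[LHS]mulr_natr divrK. Qed.

(** The uniqueness principle behind the functional identities below. *)
Lemma fps_deriv_inj f g : fps_deriv f = fps_deriv g -> f 0%N = g 0%N -> f = g.
Proof.
move=> dfg fg0; apply: fpsP => -[//|n]; apply: (@mulrSn_inj n).
exact: (congr1 (fun h : {fps A} => h n) dfg).
Qed.

(** In [(f - g) * (f + g) = 0] the second factor has constant term 2, hence is invertible. *)
Lemma fps_sqr_inj f g : f 0%N = 1 -> g 0%N = 1 -> f ^+ 2 = g ^+ 2 -> f = g.
Proof.
move=> f0 g0 /eqP; rewrite -subr_eq0 subr_sqr => /eqP fg.
have fgU : f + g \is a GRing.unit.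
  by rewrite fps_unitE fps_coefD f0 g0; apply: (natU 1).
by apply/eqP; rewrite -subr_eq0; apply/eqP/(mulIr fgU); rewrite fg mul0r.
Qed.

(** The binomial recurrence says [(1 + X) s' = s / 2], so [y = s ^+ 2] solves [(1 + X) y' = y], and
    the coefficients of [y] follow one by one. *)
Lemma sqrt1p_series_sqr : sqrt1p_series A ^+ 2 = 1 + fpsX A.
Proof.
set s := sqrt1p_series A.
have sS n : s n.+1 *+ n.+1 = s n * (2^-1 - n%:R).
  rewrite /s /= big_ord_recr /= factS natrM invrM ?fact_unit //.
  rewrite mulrA -[LHS]mulr_natr divrK //; ring.
have ds : (1 + fpsX A) * fps_deriv s = 2^-1%:S * s.
  apply: fpsP => n; rewrite fps_coefCM mulrDl mul1r fps_coefD fps_coefXM /=.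
  rewrite sS; case: n => [|n]; first by rewrite subr0 addr0 mulrC.
  by rewrite mulrBr mulr_natr subrK mulrC.
have h2 : (2^-1 : A)%:S *+ 2 = 1.
  by rewrite -rmorphMn -[_ *+ 2]mulr_natr mulVr ?rmorph1 //; apply: (natU 1).
have dy : (1 + fpsX A) * fps_deriv (s ^+ 2) = s ^+ 2.
  rewrite expr2 fps_derivM mulrDr mulrA ds mulrCA ds.
  by rewrite -[RHS]mul1r -h2; ring.
have yS n : (s ^+ 2) n.+1 *+ n.+1 = (s ^+ 2) n * (1 - n%:R).
  move/(congr1 (fun f : {fps A} => f n)): dy.
  rewrite mulrDl mul1r fps_coefD fps_coefXM /=.
  case: n => [|n] /=; first by rewrite addr0 subr0 mulr1.
  by move=> e; apply/eqP; rewrite mulrBr mulr1 mulr_natr eq_sym subr_eq e.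
have y0 : (s ^+ 2) 0%N = 1.
  by rewrite fps_coef0X /s /= big_ord0 mul1r fact0 invr1 expr1n.
have y1 : (s ^+ 2) 1%N = 1.
  by have := yS 0%N; rewrite subr0 mulr1 mulr1n y0.
(* The factor [1 - n%:R] of the recurrence vanishes at [n = 1], which stops the series. *)
have y2 n : (s ^+ 2) n.+2 = 0.
  elim: n => [|n IH]; [apply: (@mulrSn_inj 1) | apply: (@mulrSn_inj n.+2)].
    by rewrite yS mul0rn y1 subrr mulr0.
  by rewrite yS mul0rn IH mul0r.
apply: fpsP => -[|[|n]]; rewrite fps_coefD fps_coef1 ?(y0, y1, y2) /=.
- by rewrite addr0.
- by rewrite add0r.
- by rewrite addr0.
Qed.

Lemma fps_sqrt_sqr q : q 0%N = 1 -> fps_sqrt (q ^+ 2) = q.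
Proof.
move=> q0; have u0 : (q ^+ 2 - 1) 0%N = 0.
  by rewrite fps_coefD fps_coefN fps_coef1 fps_coef0X q0 expr1n subrr.
apply: fps_sqr_inj => //.
  by rewrite fps_comp_coef0 /= big_ord0 mul1r fact0 invr1.
rewrite /fps_sqrt !expr2 -fps_compM // -[_ * _]expr2 sqrt1p_series_sqr.
by rewrite fps_compD fps_comp1 fps_compX // addrC -expr2 subrK.
Qed.

Lemma fps_deriv_sinh : fps_deriv (sinh_series A) = cosh_series A.
Proof.
apply: fpsP => n /=; case: (odd n) => /=; first by rewrite mul0rn.
exact: invr_factS.
Qed.

Lemma fps_deriv_cosh : fps_deriv (cosh_series A) = sinh_series A.
Proof.
apply: fpsP => n /=; case: (odd n) => /=; last by rewrite mul0rn.
exact: invr_factS.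
Qed.

Lemma cosh_series_sqr : cosh_series A ^+ 2 = 1 + sinh_series A ^+ 2.
Proof.
apply: fps_deriv_inj.
  rewrite !expr2 fps_derivD (fps_derivC 1) add0r !fps_derivM.
  by rewrite fps_deriv_sinh fps_deriv_cosh addrC ![_ * cosh_series _]mulrC.
by rewrite fps_coefD fps_coef1 !fps_coef0X /= fact0 invr1 expr1n expr0n addr0.
Qed.

Lemma fps_cosh_sqr f : f 0%N = 0 -> fps_cosh f ^+ 2 = 1 + fps_sinh f ^+ 2.
Proof.
move=> f0; rewrite !expr2 -!fps_compM // -!expr2 cosh_series_sqr.
by rewrite fps_compD fps_comp1.
Qed.

Lemma natr_unit n : (0 < n)%N -> (n%:R : A) \is a GRing.unit.
Proof. by case: n => // n _; apply: natU. Qed.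

Lemma deriv_asinh0 : fps_deriv (asinh_series A) 0%N = 1.
Proof. by rewrite /= expr0 fact0 mul1r divr1. Qed.

(** Differentiation cancels the factor 2k+1 of the denominator, leaving the binomial coefficients of
    (1 + z^2)^(-1/2). *)
Lemma deriv_asinh_even k :
  fps_deriv (asinh_series A) k.*2 * (4 ^ k * k`! ^ 2)%:R =
  (-1) ^+ k * (k.*2)`!%:R.
Proof.
have dU : ((4 ^ k * k`! ^ 2)%:R : A) \is a GRing.unit.
  by apply: natr_unit; rewrite muln_gt0 !expn_gt0 fact_gt0.
rewrite /= odd_double /= uphalf_double -[_ *+ k.*2.+1]mulr_natr [(_ * k.*2.+1)%:R]natrM -mulrA.
by rewrite [_.+1%:R * _]mulrC divrK ?unitrM ?dU ?natU.
Qed.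

(** The coefficient form of [(1 + X^2) b' = - X b] for the derivative [b] of asinh. *)
Lemma deriv_asinh_rec n :
  fps_deriv (asinh_series A) n.+2 *+ n.+2 =
  - fps_deriv (asinh_series A) n *+ n.+1.
Proof.
have [odd_n|] := boolP (odd n).
  by rewrite /= odd_n /= !mul0rn oppr0 mul0rn.
move/even_halfK <-; set k := n./2; rewrite -doubleS.
have dU : ((4 ^ k.+1 * k.+1`! ^ 2)%:R : A) \is a GRing.unit.
  by apply: natr_unit; rewrite muln_gt0 !expn_gt0 fact_gt0.
apply: (mulIr dU); rewrite mulrnAl deriv_asinh_even.
have -> : (4 ^ k.+1 * k.+1`! ^ 2 = 4 ^ k * k`! ^ 2 * (4 * k.+1 ^ 2))%N.
  by rewrite factS expnMn expnS; ring.
rewrite mulrnAl mulNr natrM mulrA deriv_asinh_even doubleS !factS.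
rewrite -[LHS]mulr_natr -[RHS]mulr_natr exprS mulN1r !mulNr -!mulrA -!natrM.
(* The factorial is generalised so that [ring] sees an atom. *)
congr (- (_ * _%:R)); move: (k.*2)`! => F; rewrite -doubleS -!mul2n; ring.
Qed.

(** By the differential equation the left side has derivative [2 b ((1 + X^2) b' + X b) = 0]. *)
Lemma deriv_asinh_sqr :
  fps_deriv (asinh_series A) ^+ 2 * (1 + fpsX A ^+ 2) = 1.
Proof.
set b := fps_deriv _.
have ode : (1 + fpsX A ^+ 2) * fps_deriv b = - fpsX A * b.
  apply: fpsP => n; rewrite mulrDl mul1r expr2 -mulrA mulNr fps_coefD fps_coefN.
  rewrite !fps_coefXM; case: n => [|n].
    by rewrite /b /= mulr1n mul0rn addr0 oppr0.
  rewrite fps_coefXM [fps_deriv b n.+1]fps_coef_deriv deriv_asinh_rec -/b.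
  case: n => [|n]; first by rewrite mulr1n addr0.
  by rewrite [fps_deriv b n]fps_coef_deriv; ring.
apply: fps_deriv_inj.
  rewrite (fps_derivC 1) !expr2 fps_derivM fps_derivM fps_derivD (fps_derivC 1).
  rewrite fps_derivM fps_derivX; move: ode; set b' := fps_deriv b => ode.
  transitivity (2 * b * ((1 + fpsX A ^+ 2) * b' + fpsX A * b)); first by ring.
  by rewrite ode; ring.
by rewrite fps_coef0M fps_coefD fps_coef1 !fps_coef0X deriv_asinh0 expr0n addr0 expr1n mulr1.
Qed.

(** Both sides have the same derivative once asinh'(sinh f) cosh f = 1; this product has constant
    term 1, and its square is 1 because cosh^2 = 1 + sinh^2. *)
Lemma fps_asinh_sinh f : f 0%N = 0 -> fps_asinh (fps_sinh f) = f.
Proof.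
move=> f0; have s0 : fps_sinh f 0%N = 0 by rewrite fps_comp_coef0.
apply: fps_deriv_inj; last by rewrite fps_comp_coef0.
rewrite /fps_asinh fps_deriv_comp // fps_deriv_comp // fps_deriv_sinh mulrA.
set a := fps_comp _ (fps_sinh f); rewrite -/(fps_cosh f).
suff -> : a * fps_cosh f = 1 by rewrite mul1r.
apply: fps_sqr_inj.
- by rewrite fps_coef0M !fps_comp_coef0 deriv_asinh0 mul1r /= fact0 invr1.
- by rewrite fps_coef1.
rewrite [1 ^+ 2]expr1n exprMn (fps_cosh_sqr f0).
transitivity (fps_comp (fps_deriv (asinh_series A) ^+ 2 * (1 + fpsX A ^+ 2)) (fps_sinh f)).
  rewrite (fps_compM _ _ s0) fps_compD fps_comp1 !expr2 !(fps_compM _ _ s0).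
  by rewrite (fps_compX s0).
by rewrite deriv_asinh_sqr fps_comp1.
Qed.

End SpecialSeries.

(** * Ring morphisms applied coefficientwise *)

Section CoefficientMap.
Variables (A B : comNzRingType) (phi : {rmorphism A -> B}).
Implicit Types f g : {fps A}.

Definition fps_map f : {fps B} := FPS (fun n => phi (f n)).

Fact fps_map_is_zmod_morphism : zmod_morphism fps_map.
Proof. by move=> f g; apply: fpsP => n /=; rewrite rmorphB. Qed.

Fact fps_map_is_monoid_morphism : monoid_morphism fps_map.
Proof.
split=> [|f g]; apply: fpsP => n /=; first by case: eqP; rewrite ?rmorph1 ?rmorph0.
by rewrite rmorph_sum; apply: eq_bigr => i _; rewrite rmorphM.
Qed.

HB.instance Definition _ :=
  GRing.isZmodMorphism.Build {fps A} {fps B} fps_map fps_map_is_zmod_morphism.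
HB.instance Definition _ :=
  GRing.isMonoidMorphism.Build {fps A} {fps B} fps_map fps_map_is_monoid_morphism.

Lemma fps_mapC a : fps_map a%:S = (phi a)%:S.
Proof. by apply: fpsP => n /=; case: eqP; rewrite ?rmorph0. Qed.

Lemma fps_map_comp f g :
  fps_map (fps_comp f g) = fps_comp (fps_map f) (fps_map g).
Proof.
apply: fpsP => n /=; rewrite rmorph_sum; apply: eq_bigr => i _.
by rewrite rmorphM -rmorphXn.
Qed.

End CoefficientMap.

Section SeriesMap.
Variables (A B : comUnitRingType) (phi : {rmorphism A -> B}).
Hypothesis natU : forall n, (n.+1%:R : A) \is a GRing.unit.

Lemma fps_map_asinh : fps_map phi (asinh_series A) = asinh_series B.
Proof.
apply: fpsP => n /=; case: ifP => odd_n; last by rewrite rmorph0.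
rewrite rmorphM rmorphM rmorphXn rmorphN1 rmorphV ?rmorph_nat //.
apply: natr_unit => //; case: n odd_n => // n _.
by rewrite !muln_gt0 !expn_gt0 fact_gt0.
Qed.

Lemma fps_map_sqrt1p : fps_map phi (sqrt1p_series A) = sqrt1p_series B.
Proof.
apply: fpsP => n /=; rewrite rmorphM rmorphV ?rmorph_nat ?fact_unit //.
rewrite rmorph_prod; congr (_ / _); apply: eq_bigr => i _.
by rewrite rmorphB rmorphV ?rmorph_nat //; apply: (natU 1).
Qed.

End SeriesMap.

(* R[x][[y]] -> R[[y]][[x]]; the holistic series lies in R[gamma][[d/dx]], since
   each of its powers of gamma carries at least as high a power of delta. *)
Section Swap.
Variable A : comNzRingType.
Implicit Types f g : {fps {poly A}}.

Definition fps_swap f : {fps {fps A}} := FPS (fun n => FPS (fun m => (f m)`_n)).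

Fact fps_swap_is_zmod_morphism : zmod_morphism fps_swap.
Proof.
by move=> f g; do 2![apply: fpsP => ?]; rewrite /= coefB.
Qed.

Fact fps_swap_is_monoid_morphism : monoid_morphism fps_swap.
Proof.
split=> [|f g]; apply: fpsP => n; apply: fpsP => m.
  by case: m n => [|m] [|n]; rewrite /= ?coef1 ?coef0.
rewrite /= coef_sum [RHS]fps_coef_sum.
under eq_bigr => i _ do rewrite coefM.
by rewrite exchange_big; apply: eq_bigr.
Qed.

HB.instance Definition _ := GRing.isZmodMorphism.Build
  {fps {poly A}} {fps {fps A}} fps_swap fps_swap_is_zmod_morphism.
HB.instance Definition _ := GRing.isMonoidMorphism.Build
  {fps {poly A}} {fps {fps A}} fps_swap fps_swap_is_monoid_morphism.

Lemma fps_swap_map_polyC (u : {fps A}) : fps_swap (fps_map polyC u) = u%:S.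
Proof.
by apply: fpsP => n; apply: fpsP => m /=; rewrite coefC; case: eqP.
Qed.

Lemma fps_swapX : fps_swap ('X : {poly A})%:S = fpsX {fps A}.
Proof.
apply: fpsP => n; apply: fpsP => m /=.
rewrite (fun_if (fun p : {poly A} => p`_n)) coefX coef0.
by case: eqP => [->|/eqP/negPf m0]; case: eqP; rewrite // fps_coef1 m0.
Qed.

(* Composition in y on the left, in x on the right: [g] must have no constant
   term in either variable for both to be finite sums of powers of [g]. *)
Lemma fps_swap_comp (u : {fps A}) g : g 0%N = 0 -> fps_swap g 0%N = 0 ->
  fps_swap (fps_comp (fps_map polyC u) g) =
  fps_comp (fps_map (@fpsC A) u) (fps_swap g).
Proof.
move=> g0 sg0; apply: fpsP => n; apply: fpsP => m.
have swE k : ((g ^+ k) m)`_n = (fps_swap g ^+ k) n m by rewrite -rmorphXn.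
(* A common range for both truncated sums: powers above [m] vanish by their order in y, powers above
   [n] by their order in x. *)
transitivity (\sum_(k < m.+1 + n.+1) u k * ((g ^+ k) m)`_n).
  rewrite big_split_ord /= [X in _ + X]big1 ?addr0 => [|i _]; last first.
    by rewrite fps_coefX_small ?coef0 ?mulr0 // ltnS leq_addr.
  by rewrite coef_sum; apply: eq_bigr => i _; rewrite coefCM.
rewrite addnC big_split_ord /= [X in _ + X]big1 ?addr0 => [|i _]; last first.
  by rewrite swE fps_coefX_small ?mulr0 // ltnS leq_addr.
by rewrite fps_coef_sum; apply: eq_bigr => i _; rewrite fps_coefCM swE.
Qed.

End Swap.

(** * Transport of the holistic formula along ring morphisms *)

Section HolisticFormula.
Variables (K L : comUnitRingType) (psi : {rmorphism K -> L}).
Hypotheses (unit2 : (2 : K) \is a GRing.unit) (unit4 : (4 : K) \is a GRing.unit).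
Variables (theta gamma mu delta : K).

Lemma rmorph_radicand :
  psi (1 + 2^-1 * gamma * delta ^+ 2 - gamma * theta * mu * delta
       + 4^-1 * gamma ^+ 2 * (theta ^+ 2 - 1) * delta ^+ 2) =
  1 + 2^-1 * psi gamma * psi delta ^+ 2
    - psi gamma * psi theta * psi mu * psi delta
    + 4^-1 * psi gamma ^+ 2 * (psi theta ^+ 2 - 1) * psi delta ^+ 2.
Proof.
have V2 : psi 2^-1 = 2^-1 by rewrite rmorphV ?rmorph_nat.
have V4 : psi 4^-1 = 4^-1 by rewrite rmorphV ?rmorph_nat.
by rewrite !(rmorphB, rmorphD, rmorphM, rmorphXn, rmorph1) V2 V4.
Qed.

Lemma rmorph_asinh_arg (s : K) : s \is a GRing.unit ->
  psi (2^-1 * gamma * (mu - 2^-1 * theta * delta) * delta / s) =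
  2^-1 * psi gamma * (psi mu - 2^-1 * psi theta * psi delta) * psi delta / psi s.
Proof.
move=> sU; have V2 : psi 2^-1 = 2^-1 by rewrite rmorphV ?rmorph_nat.
by rewrite rmorphM [psi s^-1]rmorphV // !(rmorphM, rmorphB) V2.
Qed.

Lemma rmorph_prefactor (c H a : K) : H \is a GRing.unit ->
  psi (- (2 * c / H) * a) = - (2 * psi c / psi H) * psi a.
Proof.
by move=> HU; rewrite rmorphM rmorphN !rmorphM rmorphV // rmorph_nat.
Qed.

End HolisticFormula.

Section HolisticMorphism.
Variables (A B : comUnitRingType) (phi : {rmorphism {fps A} -> {fps B}}).
Hypothesis natU : forall n, (n.+1%:R : A) \is a GRing.unit.
(** The series into which substitution commutes with [phi]: all of them for evaluation at a number,
    those without constant term in either variable for the exchange of variables. *)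
Variable I : pred {fps A}.
Hypothesis IM : forall f g, I f -> I (f * g).
Hypothesis phi_asinh : forall f, I f -> phi (fps_asinh f) = fps_asinh (phi f).
Hypothesis phi_sqrt1p : forall f, I f ->
  phi (fps_comp (sqrt1p_series A) f) = fps_comp (sqrt1p_series B) (phi f).

(** The argument of asinh and the radicand minus 1 are both multiples of [gamma * delta], so one
    membership in [I] suffices. *)
Lemma holistic_morph (c H theta gamma mu delta : {fps A}) :
  H \is a GRing.unit -> I (gamma * delta) ->
  phi (holistic c H theta gamma mu delta) =
  holistic (phi c) (phi H) (phi theta) (phi gamma) (phi mu) (phi delta).
Proof.
move=> HU Igd.
have U2 : (2 : {fps A}) \is a GRing.unit := fps_natU natU 1.
have U4 : (4 : {fps A}) \is a GRing.unit := fps_natU natU 3.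
rewrite /holistic rmorph_prefactor //; congr (_ * _).
pose w := 1 + 2^-1 * gamma * delta ^+ 2 - gamma * theta * mu * delta
          + 4^-1 * gamma ^+ 2 * (theta ^+ 2 - 1) * delta ^+ 2.
rewrite -/w; pose s := fps_sqrt w; rewrite -/s.
have Iw : I (w - 1).
  have -> : w - 1 = gamma * delta * (2^-1 * delta - theta * mu
      + 4^-1 * gamma * (theta ^+ 2 - 1) * delta) by rewrite /w; ring.
  exact: IM.
have sU : s \is a GRing.unit.
  by rewrite fps_unitE fps_comp_coef0 /= big_ord0 fact0 divr1 unitr1.
rewrite phi_asinh.
  rewrite (rmorph_asinh_arg _ U2 _ _ _ _ sU); congr (fps_asinh (_ / _)).
  by rewrite /s /fps_sqrt (phi_sqrt1p Iw) rmorphB rmorph1 (rmorph_radicand _ U2 U4).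
have -> : 2^-1 * gamma * (mu - 2^-1 * theta * delta) * delta / s =
   gamma * delta * (2^-1 * (mu - 2^-1 * theta * delta) / s) by ring.
exact: IM.
Qed.

End HolisticMorphism.

(** * Expansion of the scheme up to third order in delta *)

Section GammaExpansion.

(* The variables are [g = gamma / 24], [p = theta / 2] and [s = delta / 2], the
   radicand is [1 + 4 v], and [6 y] is the argument of asinh; with this scaling
   all coefficients are integers, so that [ring] applies without inverses. *)
Lemma holistic_expansion_algebra (K : comNzRingType) (g p mu s q r : K) :
  mu ^+ 2 = 1 + s ^+ 2 ->
  let v := 12 * g * s ^+ 2 - 24 * g * p * mu * s
           + 144 * g ^+ 2 * (4 * p ^+ 2 - 1) * s ^+ 2 in
  let y := 4 * g * s * (mu - 2 * p * s) * (1 - 2 * v + 6 * v ^+ 2 + v ^+ 3 * q) in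
  exists t, - 2 * (6 * y - 36 * y ^+ 3 + y ^+ 4 * r) =
    - (48 * g * mu * s) + 96 * p * g * (1 - 24 * g) * s ^+ 2
    + 1152 * g ^+ 2 * (1 - 8 * g + 4 * p ^+ 2 * (1 - 24 * g)) * mu * s ^+ 3
    + s ^+ 4 * t.
Proof.
move=> mu2 v y.
pose a := - (24 * g * p); pose b := 12 * g + 144 * g ^+ 2 * (4 * p ^+ 2 - 1).
have vE : v = s * (a * mu + b * s) by rewrite /v /a /b; ring.
have v2 : v ^+ 2 = s ^+ 2 * a ^+ 2
    + s ^+ 3 * (2 * a * b * mu + (a ^+ 2 + b ^+ 2) * s).
  transitivity (s ^+ 2 * (a ^+ 2 * mu ^+ 2 + 2 * a * b * mu * s
    + b ^+ 2 * s ^+ 2)); first by rewrite vE; ring.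
  by rewrite mu2; ring.
(* [f] is defined by [6 v^2 + v^3 q = 6 a^2 s^2 + s^3 f]. Below, [k] is the coefficient of [s^3] in
   [T], after [mu^2] has been replaced by [1 + s^2]. *)
pose f := 6 * (2 * a * b * mu + (a ^+ 2 + b ^+ 2) * s) + (a * mu + b * s) ^+ 3 * q.
pose T := (mu - 2 * p * s) * (1 - 2 * v + 6 * v ^+ 2 + v ^+ 3 * q).
pose k := - 2 * a - 2 * p * (6 * a ^+ 2 - 2 * b) + (mu - 2 * p * s) * f.
pose l := (- 2 * a - 2 * p) + s * mu * (6 * a ^+ 2 - 2 * b + 4 * a * p) + s ^+ 2 * k.
have TE : T = mu + s * l.
  transitivity (mu - 2 * a * mu ^+ 2 * s - 2 * p * s
    + s ^+ 2 * (mu * (6 * a ^+ 2 - 2 * b + 4 * a * p))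
    - s ^+ 3 * (2 * p * (6 * a ^+ 2 - 2 * b)) + s ^+ 3 * ((mu - 2 * p * s) * f)).
    by rewrite /T v2 vE /f; ring.
  by rewrite mu2 /l /k; ring.
have T3 : T ^+ 3 = mu + s * (s * mu + 3 * mu ^+ 2 * l + 3 * s * mu * l ^+ 2
    + s ^+ 2 * l ^+ 3).
  transitivity (mu * mu ^+ 2 + s * (3 * mu ^+ 2 * l + 3 * s * mu * l ^+ 2
    + s ^+ 2 * l ^+ 3)); first by rewrite TE; ring.
  by rewrite {1}mu2; ring.
have yE : y = 4 * g * s * T by rewrite /y /T; ring.
clearbody T; rewrite yE.
(* Three sources of order [s^4]: the tail [k] of the linear term, the difference [T^3 - mu] in the
   cubic term, and the asinh remainder. *)
exists (- 48 * g * k + 4608 * g ^+ 3 * (s * mu + 3 * mu ^+ 2 * l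
  + 3 * s * mu * l ^+ 2 + s ^+ 2 * l ^+ 3) - 512 * g ^+ 4 * T ^+ 4 * r).
transitivity (- 48 * g * s * T + 4608 * g ^+ 3 * s ^+ 3 * T ^+ 3
  - s ^+ 4 * (512 * g ^+ 4 * T ^+ 4 * r)); first by ring.
rewrite T3 TE; set m := _ + s ^+ 2 * l ^+ 3; rewrite /l /a /b; ring.
Qed.

Variable A : comUnitRingType.
Hypothesis natU : forall n, (n.+1%:R : A) \is a GRing.unit.
Implicit Types v y : {fps A}.

(** The scaling by 4 turns the binomial coefficients 1/2 and -1/8 into 2 and -2; the remainder
    carries [4^3 = 64]. *)
Lemma fps_sqrt_expand v : v 0%N = 0 ->
  exists r, fps_sqrt (1 + 4 * v) = 1 + 2 * v - 2 * v ^+ 2 + v ^+ 3 * r.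
Proof.
move=> v0; have w0 : (4 * v) 0%N = 0 by rewrite fps_coef0M v0 mulr0.
have h2 : 2 * (2^-1 : A) = 1 by rewrite mulrV //; apply: (natU 1).
have s0 : sqrt1p_series A 0%N = 1 by rewrite /= big_ord0 fact0 divr1.
have s1 : sqrt1p_series A 1%N = 2^-1.
  by rewrite /= big_ord_recl big_ord0 mulr1 subr0 divr1.
have s2 : sqrt1p_series A 2%N = 2^-1 * (2^-1 - 1) * 2^-1.
  by rewrite /= !big_ord_recl big_ord0 mulr1 subr0.
have E1 : (2^-1 : A)%:S * 4 = 2.
  rewrite -(rmorph_nat (@fpsC A) 4) -rmorphM -(rmorph_nat (@fpsC A) 2).
  by congr fpsC; transitivity (2 * (2 * 2^-1) : A); [ring | rewrite h2 mulr1].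
have E2 : (2^-1 * (2^-1 - 1) * 2^-1 : A)%:S * 16 = - 2.
  rewrite -(rmorph_nat (@fpsC A) 16) -rmorphM -(rmorph_nat (@fpsC A) 2) -rmorphN.
  congr fpsC; transitivity ((2 * 2^-1) * (2 * 2^-1 - 2) * (2 * 2^-1) * 2 : A).
    by ring.
  by rewrite h2; ring.
rewrite /fps_sqrt addrC addKr.
move: (sqrt1p_series A) s0 s1 s2 => a s0 s1 s2.
rewrite (@fps_comp_split _ _ _ 3) //; set F := fps_comp _ _; exists (64 * F).
rewrite !big_ord_recl big_ord0 /= /bump /= s0 s1 s2 rmorph1.
set e1 := (2^-1)%:S in E1 *; set e2 := (_ * _ * _)%:S in E2 *.
transitivity (1 + (e1 * 4) * v + (e2 * 16) * v ^+ 2 + v ^+ 3 * (64 * F)).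
  by ring.
by rewrite E1 E2; ring.
Qed.

Lemma fps_sqrt_inv_expand v : v 0%N = 0 ->
  exists r, (fps_sqrt (1 + 4 * v))^-1 = 1 - 2 * v + 6 * v ^+ 2 + v ^+ 3 * r.
Proof.
move=> v0; have [r] := fps_sqrt_expand v0; set S := fps_sqrt _ => SE.
have SU : S \is a GRing.unit.
  rewrite fps_unitE fps_comp_coef0 /= big_ord0 fact0 divr1.
  exact: unitr1.
(* The defect of the approximate inverse: [S * (1 - 2 v + 6 v^2) = 1 + v^3 e]. *)
pose e := 16 - 12 * v + r * (1 - 2 * v + 6 * v ^+ 2).
exists (- e / S); apply: (mulrI SU); rewrite mulrV //.
transitivity (S * (1 - 2 * v + 6 * v ^+ 2) - v ^+ 3 * e * (S / S)); last by ring.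
by rewrite mulrV // SE /e; ring.
Qed.

Lemma fps_asinh_expand y : y 0%N = 0 ->
  exists r, fps_asinh (6 * y) = 6 * y - 36 * y ^+ 3 + y ^+ 4 * r.
Proof.
move=> y0; have z0 : (6 * y) 0%N = 0 by rewrite fps_coef0M y0 mulr0.
have a1 : asinh_series A 1%N = 1.
  by rewrite /= expr0 !mul1r fact0 invr1.
have a3 : (asinh_series A 3%N)%:S * 216 = - 36.
  rewrite -(rmorph_nat (@fpsC A) 216) -rmorphM -(rmorph_nat (@fpsC A) 36) -rmorphN.
  congr fpsC; rewrite /= expr1 /=.
  have -> : (216 : A) = (4 ^ 1 * 1`! ^ 2 * 3)%:R * 18 by rewrite -natrM.
  rewrite mulrA divrK; last by apply: natr_unit.
  by rewrite -[2`!]/2%N; ring.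
have a0 : asinh_series A 0%N = 0 by [].
have a2 : asinh_series A 2%N = 0 by [].
rewrite /fps_asinh; move: (asinh_series A) a0 a1 a2 a3 => a a0 a1 a2 a3.
rewrite (@fps_comp_split _ _ _ 4) //; set F := fps_comp _ _; exists (1296 * F).
rewrite !big_ord_recl big_ord0 /= /bump /= a0 a1 a2 rmorph1 rmorph0.
transitivity (6 * y + ((a 3%N)%:S * 216) * y ^+ 3 + y ^+ 4 * (1296 * F)).
  by ring.
by rewrite a3; ring.
Qed.

(** Here [delta] may be constant in the outer variable, so it is the factor [gamma] that makes the
    substitutions legitimate. *)
Lemma holistic_expansion (c H theta gamma mu s : {fps A}) :
  gamma 0%N = 0 -> mu ^+ 2 = 1 + s ^+ 2 ->
  let delta := 2 * s in
  exists r, holistic c H theta gamma mu delta = c / H *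
    (- gamma * mu * delta
     + 2^-1 * theta * gamma * (1 - gamma) * delta ^+ 2
     + 4^-1 * gamma ^+ 2 * (1 - 3^-1 * gamma + theta ^+ 2 * (1 - gamma))
         * mu * delta ^+ 3
     + delta ^+ 4 * r).
Proof.
move=> gamma0 mu2 delta; pose g := gamma / 24; pose p := theta / 2.
have natV n : (n.+1%:R : {fps A})^-1 * n.+1%:R = 1.
  by rewrite mulVr //; apply: fps_natU.
have gE : gamma = 24 * g by rewrite /g mulrCA mulrC [24 * _]mulrC natV mul1r.
have pE : theta = 2 * p by rewrite /p mulrCA mulrC [2 * _]mulrC natV mul1r.
have g2 : 2^-1 * gamma = 12 * g.
  by rewrite gE; transitivity ((2^-1 * 2) * (12 * g)); [ring|rewrite natV mul1r].
have g3 : 3^-1 * gamma = 8 * g.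
  by rewrite gE; transitivity ((3^-1 * 3) * (8 * g)); [ring|rewrite natV mul1r].
have g4 : 4^-1 * gamma ^+ 2 = 144 * g ^+ 2.
  rewrite gE; transitivity ((4^-1 * 4) * (144 * g ^+ 2)); first by ring.
  by rewrite natV mul1r.
have p2 : 2^-1 * theta = p.
  by rewrite pE mulrA natV mul1r.
have g0 : g 0%N = 0 by rewrite fps_coef0M gamma0 mul0r.
rewrite /holistic g2 g3 g4 p2 /delta.
pose v := 12 * g * s ^+ 2 - 24 * g * p * mu * s
           + 144 * g ^+ 2 * (4 * p ^+ 2 - 1) * s ^+ 2.
have v0 : v 0%N = 0.
  have -> : v = g * (12 * s ^+ 2 - 24 * p * mu * s
    + 144 * g * (4 * p ^+ 2 - 1) * s ^+ 2) by rewrite /v; ring.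
  by rewrite fps_coef0M g0 mul0r.
set w := (X in fps_sqrt X); have {w}-> : w = 1 + 4 * v.
  by rewrite /w /v pE gE; ring.
have [q ->] := fps_sqrt_inv_expand v0.
pose y := 4 * g * s * (mu - 2 * p * s) * (1 - 2 * v + 6 * v ^+ 2 + v ^+ 3 * q).
have y0 : y 0%N = 0.
  have -> : y = g * (4 * s * (mu - 2 * p * s)
    * (1 - 2 * v + 6 * v ^+ 2 + v ^+ 3 * q)) by rewrite /y; ring.
  by rewrite fps_coef0M g0 mul0r.
set z := (X in fps_asinh X); have {z}-> : z = 6 * y by rewrite /z /y; ring.
have [r ->] := fps_asinh_expand y0.
have [t] := @holistic_expansion_algebra _ g p mu s q r mu2; rewrite -/v -/y => tE.
(* [delta ^+ 4] is [16 * s ^+ 4]. *)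
exists (16^-1 * t).
transitivity (c / H * (- 2 * (6 * y - 36 * y ^+ 3 + y ^+ 4 * r))); first by ring.
rewrite tE; congr (_ * _); transitivity (
    - (48 * g * mu * s) + 96 * p * g * (1 - 24 * g) * s ^+ 2
    + 1152 * g ^+ 2 * (1 - 8 * g + 4 * p ^+ 2 * (1 - 24 * g)) * mu * s ^+ 3
    + (16^-1 * 16) * s ^+ 4 * t); first by rewrite natV mul1r.
by rewrite gE pE; ring.
Qed.

End GammaExpansion.

Theorem mainTheorem9 (R : realType) (c H theta : R) (hH : 0 < H) :
  (* at full coupling, the equivalent PDE is U_t = - c U_x *)
  consistent_with_wave c H (holistic_scheme c H theta 1)
  /\
  (* the scheme is the sum of its expansion in powers of gamma, ... *)
  (forall gamma : R,
     gamma_sums_to (holistic_gamma_series c H theta) gamma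
       (equivalent_PDE H (holistic_scheme c H theta gamma)))
  /\
  (* ... whose terms below the fourth order in delta are the stated ones *)
  (let gamma : {fps {fps R}} := fpsX _ in
   let th : {fps {fps R}} := theta%:S%:S in
   let mu : {fps {fps R}} := (mu_x H)%:S in
   let delta : {fps {fps R}} := (delta_x H)%:S in
   exists r : {fps {fps R}},
     holistic_gamma_series c H theta =
     (c / H)%:S%:S *
       (- gamma * mu * delta
        + 2^-1 * th * gamma * (1 - gamma) * delta ^+ 2
        + 4^-1 * gamma ^+ 2 * (1 - 3^-1 * gamma + th ^+ 2 * (1 - gamma))
            * mu * delta ^+ 3
        + delta ^+ 4 * r)).
Proof.
have natR n : (n.+1%:R : R) \is a GRing.unit by rewrite unitfE Num.Theory.pnatr_eq0.
have natF := fps_natU natR.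
have natP n : (n.+1%:R : {poly R}) \is a GRing.unit.
  by rewrite -(rmorph_nat polyC); apply: rmorph_unit.
have HU : H \is a GRing.unit by rewrite unitfE (Order.POrderTheory.gt_eqF hH).
have h0 : ((H / 2)%:S * dx R) 0%N = 0 by rewrite fps_coef0M /= mulr0.
have mu2 : mu_x H ^+ 2 = 1 + fps_sinh ((H / 2)%:S * dx R) ^+ 2.
  exact: fps_cosh_sqr.
have d0 : delta_x H 0%N = 0 by rewrite fps_coef0M fps_comp_coef0 /= mulr0.
split; [|split].
- rewrite /consistent_with_wave /equivalent_PDE /holistic_scheme /holistic.
  rewrite rmorph1; set mu := mu_x H in mu2 *; set s := fps_sinh _ in mu2 *.
  have V2 : (2^-1 : {fps R}) * 2 = 1 by rewrite mulVr //; apply: (natF 1).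
  pose p := 2^-1 * theta%:S; have pE : theta%:S = 2 * p.
    by rewrite /p mulrCA mulrA V2 mul1r.
  pose q := mu - p * delta_x H.
  set w := (X in fps_sqrt X).
  have -> : w = q ^+ 2.
    have V4 : (4^-1 : {fps R}) * 4 = 1 by rewrite mulVr //; apply: (natF 3).
    transitivity (1 + (2^-1 * 2) * (2 * s ^+ 2) - 4 * p * mu * s
       + (4^-1 * 4) * (4 * p ^+ 2 - 1) * s ^+ 2).
      by rewrite /w /delta_x -/s pE; ring.
    rewrite V2 V4 /q /delta_x -/s.
    transitivity (1 + s ^+ 2 - 4 * p * mu * s + 4 * p ^+ 2 * s ^+ 2); first by ring.
    by rewrite -mu2; ring.
  (* Constant term 1 both selects [q] as the root of [q ^+ 2] and makes it invertible, so that it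
     cancels in the argument of asinh. *)
  have q0 : q 0%N = 1.
    rewrite fps_coefD fps_coefN fps_coef0M d0 mulr0 subr0 fps_comp_coef0 /=.
    by rewrite fact0 invr1.
  rewrite (fps_sqrt_sqr natR q0) mulr1 -/p -/q.
  have qU : q \is a GRing.unit by rewrite fps_unitE q0 unitr1.
  have -> : 2^-1 * q * delta_x H / q = s.
    by rewrite [_ * q * _]mulrAC (mulrK qU) /delta_x mulrA V2 mul1r.
  rewrite (fps_asinh_sinh natR h0) mulNr mulNr; congr (- _).
  have -> : (H / 2)%:S = H%:S / 2 :> {fps R}.
    by rewrite rmorphM rmorphV ?rmorph_nat //; apply: (natR 1).
  rewrite mulrA; congr (_ * _).
  transitivity ((2^-1 * 2) * ((H%:S)^-1 * H%:S) * c%:S); first by ring.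
  by rewrite V2 mulVr ?mul1r // fps_unitE.
- move=> gamma.
  pose emb := fps_map (@polyC R).
  pose h : {fps {poly R}} :=
    holistic (emb c%:S) (emb H%:S) (emb theta%:S) ('X)%:S
      (emb (mu_x H)) (emb (delta_x H)).
  have HUP : emb H%:S \is a GRing.unit.
    by apply: rmorph_unit; rewrite fps_unitE.
  have hS : fps_swap h = holistic_gamma_series c H theta.
    (* In the product of gamma and delta, delta removes the constant term in d/dx and gamma the one
       in gamma. *)
    pose I (f : {fps {poly R}}) := (f 0%N == 0) && (fps_swap f 0%N == 0).
    have I0 f : I f -> f 0%N = 0 by case/andP => /eqP.
    have sI0 f : I f -> fps_swap f 0%N = 0 by case/andP => _ /eqP.
    have IM f g : I f -> I (f * g).
      move=> If; rewrite /I rmorphM fps_coef0M [fps_coef (_ * _) _]fps_coef0M.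
      by rewrite (I0 f If) (sI0 f If) !mul0r !eqxx.
    have asinhI f : I f -> fps_swap (fps_asinh f) = fps_asinh (fps_swap f).
      move=> If; rewrite /fps_asinh -(fps_map_asinh polyC natR).
      by rewrite (fps_swap_comp _ (I0 f If) (sI0 f If)) (fps_map_asinh _ natR).
    have sqrtI f : I f -> fps_swap (fps_comp (sqrt1p_series _) f) =
        fps_comp (sqrt1p_series _) (fps_swap f).
      move=> If; rewrite -(fps_map_sqrt1p polyC natR).
      by rewrite (fps_swap_comp _ (I0 f If) (sI0 f If)) (fps_map_sqrt1p _ natR).
    have Igd : I ('X%:S * emb (delta_x H)).
      have gdE : fps_swap ('X%:S * emb (delta_x H)) = fpsX _ * (delta_x H)%:S.
        by rewrite rmorphM /= fps_swapX fps_swap_map_polyC.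
      have emb0 : emb (delta_x H) 0%N = 0.
        by rewrite -[LHS]/((delta_x H 0%N)%:P) d0 polyC0.
      by rewrite /I gdE !fps_coef0M emb0 mulr0 mul0r !eqxx.
    transitivity (holistic (fps_swap (emb c%:S)) (fps_swap (emb H%:S))
      (fps_swap (emb theta%:S)) (fps_swap ('X%:S)) (fps_swap (emb (mu_x H)))
      (fps_swap (emb (delta_x H)))).
      exact: (holistic_morph natP IM asinhI sqrtI _ _ _ HUP Igd).
    by rewrite fps_swapX !fps_swap_map_polyC.
  have hE : fps_map (horner_eval gamma) h =
            equivalent_PDE H (holistic_scheme c H theta gamma).
    have embK f : fps_map (horner_eval gamma) (emb f) = f.
      by apply: fpsP => n; rewrite /= /horner_eval hornerC.
    pose I (f : {fps {poly R}}) := true.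
    pose ev : {fps {poly R}} -> {fps R} := fps_map (horner_eval gamma).
    have IM f g : I f -> I (f * g) by [].
    have asinhI f : I f -> ev (fps_asinh f) = fps_asinh (ev f).
      by move=> _; rewrite /fps_asinh /ev fps_map_comp (fps_map_asinh _ natP).
    have sqrtI f : I f -> ev (fps_comp (sqrt1p_series _) f) =
        fps_comp (sqrt1p_series _) (ev f).
      by move=> _; rewrite /ev fps_map_comp (fps_map_sqrt1p _ natP).
    transitivity (holistic (ev (emb c%:S)) (ev (emb H%:S)) (ev (emb theta%:S))
      (ev 'X%:S) (ev (emb (mu_x H))) (ev (emb (delta_x H)))).
      exact: (holistic_morph natP IM asinhI sqrtI _ _ _ HUP isT).
    by rewrite /ev !embK fps_mapC /= /horner_eval hornerX.
  (* Order [m] in d/dx is the polynomial [h m] in gamma; from its size on, partial sums equal its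
     value. *)
  move=> m; exists (size (h m)) => N hN; rewrite -hS -hE; move: h hN {hS hE} => h hN.
  rewrite fps_coef_sum [RHS](horner_coef_wide _ hN).
  by apply: eq_bigr => i _; rewrite fps_coefCM mulrC.
- rewrite /holistic_gamma_series.
  have -> : (c / H)%:S%:S = c%:S%:S / H%:S%:S :> {fps {fps R}}.
    by rewrite rmorphM rmorphM /= !rmorphV // fps_unitE.
  have -> : (delta_x H)%:S = 2 * (fps_sinh ((H / 2)%:S * dx R))%:S.
    by rewrite rmorphM rmorph_nat.
  apply: (holistic_expansion natF) => //.
  by rewrite -!rmorphXn mu2 rmorphD rmorph1.
Qed.
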